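(* Let $\mathbb{C}$ be one of the categories $\mathbb{C}_{\mathrm{rn}},\mathbb{C}_{\mathrm{vs}},\mathbb{C}_{\mathrm{ts}}$, let $T$ be a coherent theory and $\Vdash$ the forcing relation on $\mathbb{C}$ with respect to the coverage $\lhd_T$. Then for every generalized geometric implication $\phi$ with free variables in a set $Y$, every condition $(X;A)$ and every environment $\rho:Y\to\mathrm{Tm}(X)$: if $(X;A)\Vdash\phi\rho$, then $T,A\vdash_X\phi\rho$.
   Context: Fix a single-sorted first-order signature $\Sigma$ without equality and a countably infinite set of variables; $\mathrm{Tm}(X)$ is the set of $\Sigma$-terms with variables in $X$. A condition is a pair $(X;A)$, $X$ a finite set of variables, $A$ a finite set of atoms with variables in $X$; $(X,\vec x;A,\psi)$ adds fresh variables $\vec x$ and the atoms of the conjunction $\psi$. Substitutions act postfix, composition in diagram order. $\mathbb{C}_{\mathrm{ts}}$: morphisms $f:(Y;B)\to(X;A)$ are maps $f:X\to\mathrm{Tm}(Y)$ with $Af\subseteq B$; $\mathbb{C}_{\mathrm{vs}}$: those $f$ sending variables to variables; $\mathbb{C}_{\mathrm{rn}}$: those that are moreover injective. A coherent theory $T$ is a set of axioms $\forall\vec x.(\phi_0\to\exists\vec x_1.\phi_1\lor\dots\lor\exists\vec x_k.\phi_k)$ with each $\phi_i$ a finite conjunction of atoms. The relation $C\lhd_T U$ (written also $U\rhd C$) is inductively generated by: (a) $(X;A)\lhd_T\{f\}$ for every isomorphism $f$ with codomain $(X;A)$; (b) if $\phi_0\to\exists\vec x_1.\phi_1\lor\dots\lor\exists\vec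 x_n.\phi_n$ is an instance of an axiom of $T$ (terms of $\mathrm{Tm}(X)$ substituted for the universal variables) with atoms of $\phi_0$ in $A$, $\vec x_i$ fresh, and $(X,\vec x_i;A,\phi_i)\lhd_T U_i$ for all $i$, then $(X;A)\lhd_T\bigcup_ie_iU_i$ with $e_i:(X,\vec x_i;A,\phi_i)\to(X;A)$ the identity on $X$. Forcing: $C\Vdash\top$ always; $C\Vdash\bot$ iff $C\lhd_T\emptyset$; atom $\psi$: iff some $U\rhd C$ has $\psi f\in\mathrm{Fact}(D)$ for all $f:D\to C$ in $U$; $\bigwedge$: componentwise; $C\Vdash\bigvee_i\psi_i$ iff some $U\rhd C$ such that each $f:D\to C$ in $U$ has $D\Vdash\psi_if$ for some $i$; $C\Vdash\psi_1\to\psi_2$ iff for all $f:D\to C$, $D\Vdash\psi_1f$ implies $D\Vdash\psi_2f$; $C\Vdash\forall x.\psi$ iff $D\Vdash\psi[f,x:=t]$ for all $f:D\to C$ and $t\in\mathrm{Tm}(D)$; $C\Vdash\exists x.\psi$ iff some $U\rhd C$ such that each $f:D\to C$ in $U$ has some $t\in\mathrm{Tm}(D)$ with $D\Vdash\psi[f,x:=t]$. Generalized geometric implications are generated by $\phi::=\alpha\mid\phi_1\land\phi_2\mid\bigvee_{i\in I}\phi_i\mid\exists x.\phi\mid\forall x.\phi\mid\alpha\to\phi$ with $I$ small and $\alpha$ an atom, $\top$ or $\bot$ (no equality, as $\Sigma$ has none). $\Gamma\vdash_X\psi$ denotes derivability in intuitionistic natural deduction (with infinitary $\bigvee,\bigwedge$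 rules, infinitary proofs allowed) where all formulas have free variables in the finite set $X$, with quantifier rules suited to possibly empty domains: $\forall$-intro from $\Gamma\vdash_{X,x}\psi$ ($x$ not free in $\Gamma$), $\exists$-intro and $\forall$-elim only with terms $t\in\mathrm{Tm}(X)$, $\exists$-elim via $\Gamma,\psi\vdash_{X,x}\chi$; $T,A\vdash_X\psi$ means $\psi$ is derivable from the axioms of $T$ and the atoms in $A$. *)

(* Defs.v *)
From mathcomp Require Import all_boot finmap.
From mathcomp Require Import boolp classical_sets functions cardinality.

Set Implicit Arguments.
Unset Strict Implicit.
Unset Printing Implicit Defensive.

Local Open Scope classical_set_scope.

Record signature := Signature {
  fun_sym : Type;
  fun_ar : fun_sym -> nat;
  rel_sym : Type;
  rel_ar : rel_sym -> nat }.

Definition var := nat.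

(* Terms, atoms and formulas are indexed by the type [V] of their free
   variables.  A binder passes from [V] to [option V], [None] being the bound
   variable, so formulas are identified up to renaming of bound variables. *)

Inductive term (S : signature) (V : Type) : Type :=
| Var of V
| App (f : fun_sym S) of {ffun 'I_(fun_ar f) -> term S V}.
Arguments Var {S V}.
Arguments App {S V}.

Fixpoint tsubst S (V W : Type) (s : V -> term S W) (t : term S V) : term S W :=
  match t with
  | Var v => s v
  | App f args => App f [ffun i => tsubst s (args i)]
  end.

Inductive atom (S : signature) (V : Type) : Type :=
| Atom (r : rel_sym S) of {ffun 'I_(rel_ar r) -> term S V}.
Arguments Atom {S V}.

Definition asubst S (V W : Type) (s : V -> term S W) (a : atom S V) : atom S W :=
  let: Atom r args := a in Atom r [ffun i => tsubst s (args i)].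

(* Composition in diagram order: first [s], then [s']. *)
Definition scomp S (U V W : Type) (s : U -> term S V) (s' : V -> term S W) :
  U -> term S W := fun u => tsubst s' (s u).

Definition scons S (V W : Type) (s : V -> term S W) (t : term S W) :
  option V -> term S W := fun o => if o is Some v then s v else t.

Definition slift S (V W : Type) (s : V -> term S W) : option V -> term S (option W) :=
  scons (scomp s (Var \o Some)) (Var None).

(* The universe of [I] is the universe of small index sets. *)
Inductive form (S : signature) (V : Type) : Type :=
| fTop
| fBot
| fAtom of atom S V
| fAnd (I : Type) of (I -> form S V)
| fOr (I : Type) of (I -> form S V)
| fImp of form S V & form S V
| fAll of form S (option V)
| fEx of form S (option V).
Arguments fTop {S V}.
Arguments fBot {S V}.

Definition fConj S (V : Type) (p q : form S V) : form S V :=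
  fAnd (fun b : bool => if b then p else q).

Fixpoint fsubst S (V : Type) (p : form S V) : forall W : Type, (V -> term S W) -> form S W :=
  match p with
  | fTop => fun W s => fTop
  | fBot => fun W s => fBot
  | fAtom a => fun W s => fAtom (asubst s a)
  | fAnd _ p => fun W s => fAnd (fun i => fsubst (p i) s)
  | fOr _ p => fun W s => fOr (fun i => fsubst (p i) s)
  | fImp p q => fun W s => fImp (fsubst p s) (fsubst q s)
  | fAll p => fun W s => fAll (fsubst p (slift s))
  | fEx p => fun W s => fEx (fsubst p (slift s))
  end.

Definition fweak S (V : Type) (p : form S V) : form S (option V) :=
  fsubst p (Var \o Some).

(* Only the term [t : term S V] may be substituted, so the rules below are
   sound for empty domains. *)
Definition finst S (V : Type) (p : form S (option V)) (t : term S V) : form S V :=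
  fsubst p (scons Var t).

Section Conditions.
Variable S : signature.

Record cond := Cond {
  cvars : {fset var};
  fact : set (atom S cvars);
  fact_finite : finite_set fact }.
Arguments fact : clear implicits.

Inductive category := C_rn | C_vs | C_ts.

Definition admissible (K : category) (V W : Type) (s : V -> term S W) : Prop :=
  match K with
  | C_ts => True
  | C_vs => forall v, exists w, s v = Var w
  | C_rn => (forall v, exists w, s v = Var w) /\ injective s
  end.

Record hom (K : category) (D C : cond) := Hom {
  hmap :> cvars C -> term S (cvars D);
  hom_fact : asubst hmap @` fact C `<=` fact D;
  hom_admissible : admissible K hmap }.

Definition is_iso K D C (f : hom K D C) : Prop :=
  exists g : hom K C D, scomp f g =1 Var /\ scomp g f =1 Var.

Lemma tsubst_comp (U V W : Type) (s : U -> term S V) (s' : V -> term S W) t :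
  tsubst s' (tsubst s t) = tsubst (scomp s s') t.
Proof.
move: t; fix IH 1 => -[u|f args] //=.
by congr App; apply/ffunP => i; rewrite !ffunE.
Qed.

Lemma asubst_comp (U V W : Type) (s : U -> term S V) (s' : V -> term S W) a :
  asubst s' (asubst s a) = asubst (scomp s s') a.
Proof.
by case: a => r args /=; congr Atom; apply/ffunP => i; rewrite !ffunE tsubst_comp.
Qed.

Lemma admissible_comp K (U V W : Type) (s : U -> term S V) (s' : V -> term S W) :
  admissible K s -> admissible K s' -> admissible K (scomp s s').
Proof.
have vs_comp : (forall u, exists v, s u = Var v) ->
    (forall v, exists w, s' v = Var w) ->
    forall u, exists w, scomp s s' u = Var w.
  by move=> hs hs' u; rewrite /scomp; have [v ->] := hs u; exact: hs'.
case: K => //= -[hs injs] [hs' injs']; split; first exact: vs_comp.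
move=> u1 u2; rewrite /scomp => e; apply: injs; move: e.
by have [v1 ->] := hs u1; have [v2 ->] /= := hs u2 => /injs' ->.
Qed.

Lemma hcomp_fact K E D C (f : hom K D C) (g : hom K E D) :
  asubst (scomp f g) @` fact C `<=` fact E.
Proof.
move=> _ [a Ca <-]; rewrite -asubst_comp; apply: (hom_fact (h := g)).
by exists (asubst f a) => //; apply: (hom_fact (h := f)); exists a.
Qed.

Definition hcomp K E D C (f : hom K D C) (g : hom K E D) : hom K E C :=
  Hom (@hcomp_fact K E D C f g)
    (admissible_comp (hom_admissible f) (hom_admissible g)).

End Conditions.
Arguments fact {S}.

(* A finite conjunction of atoms is given by the list of its conjuncts. *)
Definition conjuncts S (V : Type) (s : seq (atom S V)) : set (atom S V) :=
  range (tnth (in_tuple s)).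

Definition fConjs S (V : Type) (s : seq (atom S V)) : form S V :=
  fAnd (fun i => fAtom (tnth (in_tuple s) i)).

(* forall x, (ax_prem -> \/_i exists y_i, ax_concl i), where the universal
   variables x are indexed by ['I_ax_univ] and the existential variables y_i of
   the i-th disjunct by ['I_(ax_exis i)]. *)
Record coherent_axiom (S : signature) := CoherentAxiom {
  ax_univ : nat;
  ax_prem : seq (atom S 'I_ax_univ);
  ax_disj : nat;
  ax_exis : 'I_ax_disj -> nat;
  ax_concl : forall i, seq (atom S ('I_ax_univ + 'I_(ax_exis i))) }.

Definition theory (S : signature) := set (coherent_axiom S).

Section Coverage.
Variable S : signature.

Definition fresh (X : {fset var}) k (x : 'I_k -> var) : Prop :=
  injective x /\ forall j, x j \notin X.

Definition ext_vars (X : {fset var}) k (x : 'I_k -> var) : {fset var} :=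
  (X `|` [fset x j | j : 'I_k])%fset.

Definition old_var (X : {fset var}) k (x : 'I_k -> var) :
  X -> ext_vars X x := fincl (fsubsetUl _ _).

Lemma new_var_subproof (X : {fset var}) k (x : 'I_k -> var) j :
  x j \in ext_vars X x.
Proof. by rewrite in_fsetU in_imfset ?orbT. Qed.

Definition new_var (X : {fset var}) k (x : 'I_k -> var) (j : 'I_k) :
  ext_vars X x := FSetSub (new_var_subproof X x j).

Definition incl (X : {fset var}) k (x : 'I_k -> var) :
  X -> term S (ext_vars X x) := Var \o @old_var X k x.

(* Universal variables are instantiated by [s], existential ones by [x]. *)
Definition instantiate n (X : {fset var}) (s : 'I_n -> term S X) k
    (x : 'I_k -> var) : 'I_n + 'I_k -> term S (ext_vars X x) :=
  fun v => match v with
           | inl i => tsubst (incl x) (s i)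
           | inr j => Var (new_var X x j)
           end.

Definition ext_fact (C : cond S) k (x : 'I_k -> var) n
    (s : 'I_n -> term S (cvars C)) (p : seq (atom S ('I_n + 'I_k))) :
    set (atom S (ext_vars (cvars C) x)) :=
  asubst (incl x) @` fact C `|` asubst (instantiate s x) @` conjuncts p.

Lemma ext_fact_finite (C : cond S) k (x : 'I_k -> var) n
    (s : 'I_n -> term S (cvars C)) (p : seq (atom S ('I_n + 'I_k))) :
  finite_set (@ext_fact C k x n s p).
Proof.
rewrite finite_setU; split; first exact/finite_image/fact_finite.
by do 2!apply: finite_image; exact: finite_finset.
Qed.

(* The condition (X, x; A, p), with [p] instantiated along [s]. *)
Definition extend (C : cond S) k (x : 'I_k -> var) n
    (s : 'I_n -> term S (cvars C)) (p : seq (atom S ('I_n + 'I_k))) : cond S :=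
  Cond (@ext_fact_finite C k x n s p).

Variables (K : category) (C : cond S) (k : nat) (x : 'I_k -> var).
Variables (n : nat) (s : 'I_n -> term S (cvars C)).
Variable p : seq (atom S ('I_n + 'I_k)).

Lemma incl_fact : asubst (incl x) @` fact C `<=` fact (@extend C k x n s p).
Proof. by move=> a Ca; left. Qed.

Lemma incl_admissible : admissible K (@incl (cvars C) k x).
Proof.
have vs v : exists w, @incl (cvars C) k x v = Var w by eexists.
case: K => //=; split=> // u v [] e.
exact/val_inj.
Qed.

Definition ext_hom : hom K (@extend C k x n s p) C :=
  @Hom S K (@extend C k x n s p) C (@incl (cvars C) k x) incl_fact incl_admissible.

End Coverage.
Arguments extend {S} C {k} x {n} s p.
Arguments ext_hom {S} K C {k} x {n} s p.

Definition family S (K : category) (C : cond S) := set {D : cond S & hom K D C}.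

Definition push S K (D C : cond S) (e : hom K D C) (U : family K D) :
  family K C := [set existT _ (projT1 g) (hcomp e (projT2 g)) | g in U].

Inductive cover S (K : category) (T : theory S) :
  forall C : cond S, family K C -> Prop :=
| cover_iso (C D : cond S) (f : hom K D C) :
    is_iso f -> cover T [set existT _ D f]
| cover_axiom (C : cond S) (a : coherent_axiom S)
    (s : 'I_(ax_univ a) -> term S (cvars C))
    (x : forall i : 'I_(ax_disj a), 'I_(ax_exis i) -> var)
    (U : forall i, family K (extend C (x i) s (ax_concl i))) :
    T a ->
    asubst s @` conjuncts (ax_prem a) `<=` fact C ->
    (forall i, fresh (cvars C) (x i)) ->
    (forall i, cover T (U i)) ->
    cover T (\bigcup_i push (ext_hom K C (x i) s (ax_concl i)) (U i)).

(* [forces K T p C r] is the forcing relation for [p] with its free variables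
   evaluated by the environment [r]. *)
Fixpoint forces S (K : category) (T : theory S) (V : Type) (p : form S V) :
    forall C : cond S, (V -> term S (cvars C)) -> Prop :=
  match p with
  | fTop => fun C r => True
  | fBot => fun C r => cover T (set0 : family K C)
  | fAtom a => fun C r =>
      exists2 U : family K C, cover T U &
        forall D (f : hom K D C), U (existT _ D f) ->
          fact D (asubst (scomp r f) a)
  | fAnd _ p => fun C r => forall i, forces K T (p i) r
  | fOr _ p => fun C r =>
      exists2 U : family K C, cover T U &
        forall D (f : hom K D C), U (existT _ D f) ->
          exists i, forces K T (p i) (scomp r f)
  | fImp p q => fun C r =>
      forall D (f : hom K D C),
        forces K T p (scomp r f) -> forces K T q (scomp r f)
  | fAll p => fun C r =>
      forall D (f : hom K D C) (t : term S (cvars D)),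
        forces K T p (scons (scomp r f) t)
  | fEx p => fun C r =>
      exists2 U : family K C, cover T U &
        forall D (f : hom K D C), U (existT _ D f) ->
          exists t : term S (cvars D), forces K T p (scons (scomp r f) t)
  end.

Inductive basic S (V : Type) : form S V -> Prop :=
| basic_top : basic fTop
| basic_bot : basic fBot
| basic_atom a : basic (fAtom a).

Inductive gen_geom_impl S : forall V : Type, form S V -> Prop :=
| ggi_basic (V : Type) (a : form S V) : basic a -> gen_geom_impl a
| ggi_conj (V : Type) (p q : form S V) :
    gen_geom_impl p -> gen_geom_impl q -> gen_geom_impl (fConj p q)
| ggi_or (V : Type) (I : Type) (p : I -> form S V) :
    (forall i, gen_geom_impl (p i)) -> gen_geom_impl (fOr p)
| ggi_ex (V : Type) (p : form S (option V)) : gen_geom_impl p -> gen_geom_impl (fEx p)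
| ggi_all (V : Type) (p : form S (option V)) : gen_geom_impl p -> gen_geom_impl (fAll p)
| ggi_imp (V : Type) (a p : form S V) :
    basic a -> gen_geom_impl p -> gen_geom_impl (fImp a p).

(* Contexts are plain predicates: [set] would bound the universe of the index
   types of [fAnd] and [fOr]. *)
Definition ctx S (V : Type) := form S V -> Prop.

Definition ctx_cons S (V : Type) (p : form S V) (G : ctx S V) : ctx S V :=
  fun q => q = p \/ G q.

Definition ctx_weak S (V : Type) (G : ctx S V) : ctx S (option V) :=
  fun q => exists2 p, G p & q = fweak p.

Inductive nd S : forall V : Type, ctx S V -> form S V -> Prop :=
| nd_hyp (V : Type) (G : ctx S V) p : G p -> nd G p
| nd_topI (V : Type) (G : ctx S V) : nd G fTop
| nd_botE (V : Type) (G : ctx S V) p : nd G fBot -> nd G p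
| nd_andI (V : Type) (G : ctx S V) (I : Type) (p : I -> form S V) :
    (forall i, nd G (p i)) -> nd G (fAnd p)
| nd_andE (V : Type) (G : ctx S V) (I : Type) (p : I -> form S V) i :
    nd G (fAnd p) -> nd G (p i)
| nd_orI (V : Type) (G : ctx S V) (I : Type) (p : I -> form S V) i :
    nd G (p i) -> nd G (fOr p)
| nd_orE (V : Type) (G : ctx S V) (I : Type) (p : I -> form S V) q :
    nd G (fOr p) -> (forall i, nd (ctx_cons (p i) G) q) -> nd G q
| nd_impI (V : Type) (G : ctx S V) p q : nd (ctx_cons p G) q -> nd G (fImp p q)
| nd_impE (V : Type) (G : ctx S V) p q : nd G (fImp p q) -> nd G p -> nd G q
| nd_allI (V : Type) (G : ctx S V) (p : form S (option V)) :
    nd (ctx_weak G) p -> nd G (fAll p)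
| nd_allE (V : Type) (G : ctx S V) (p : form S (option V)) (t : term S V) :
    nd G (fAll p) -> nd G (finst p t)
| nd_exI (V : Type) (G : ctx S V) (p : form S (option V)) (t : term S V) :
    nd G (finst p t) -> nd G (fEx p)
| nd_exE (V : Type) (G : ctx S V) (p : form S (option V)) q :
    nd G (fEx p) -> nd (ctx_cons p (ctx_weak G)) (fweak q) -> nd G q.

(* Quantification over the block of variables ['I_n]. *)
Definition block_var (V : Type) n (v : V + 'I_n.+1) : option (V + 'I_n) :=
  match v with
  | inl u => Some (inl u)
  | inr j => omap inr (unlift ord0 j)
  end.

Definition block_nil (V : Type) (v : V + 'I_0) : V :=
  match v with
  | inl u => u
  | inr j => match notF (ltn_ord j) with end
  end.

Fixpoint fQuants S (Q : forall V : Type, form S (option V) -> form S V) (V : Type) n :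
    form S (V + 'I_n) -> form S V :=
  match n with
  | 0 => fun p => fsubst p (Var \o @block_nil V)
  | n.+1 => fun p => fQuants Q (Q _ (fsubst p (Var \o @block_var V n)))
  end.

(* The sentence expressed by an axiom, regarded as a formula over any [V]. *)
Definition axiom_form S (V : Type) (a : coherent_axiom S) : form S V :=
  fQuants (@fAll S)
    (fImp
       (fsubst (fConjs (ax_prem a)) (Var \o inr))
       (fOr (fun i : 'I_(ax_disj a) =>
          fQuants (@fEx S)
            (fsubst (fConjs (ax_concl i))
               (fun v : 'I_(ax_univ a) + 'I_(ax_exis i) =>
                  Var (match v with
                       | inl u => inl (inr u)
                       | inr j => inr j
                       end)))))).

Definition derivable S (T : theory S) (V : Type) (A : set (atom S V)) (p : form S V) :
  Prop :=
  nd (fun q => (exists2 a, T a & q = axiom_form V a) \/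
               (exists2 a, A a & q = fAtom a)) p.

(* Main.v *)
(* The heart is that covers are sound for derivability: if [U] covers [(X;A)]
   and [T, B |- chi f] for every [f : (Z;B) -> (X;A)] in [U], then
   [T, A |- chi].  The theorem follows by induction on the formula.  A universal
   quantifier is tested at the extension of the condition by a generic variable,
   an implication with atomic premise at its extension by that premise; both
   extensions are injective renamings, hence available in all three categories. *)

From mathcomp Require Import all_boot finmap.
From mathcomp Require Import boolp classical_sets functions cardinality.
Require Import Defs.

Set Implicit Arguments.
Unset Strict Implicit.
Unset Printing Implicit Defensive.

Local Open Scope classical_set_scope.

(** * Substitution in terms, formulas and quantifier blocks *)

Section Substitution.
Variable S : signature.

Lemma tsubst_id (V : Type) (t : term S V) : tsubst Var t = t.
Proof.
move: t; fix IH 1 => -[u|f args] //=.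
by congr App; apply/ffunP => i; rewrite !ffunE.
Qed.

Lemma asubst_id (V : Type) (a : atom S V) : asubst Var a = a.
Proof.
by case: a => r args /=; congr Atom; apply/ffunP => i; rewrite !ffunE tsubst_id.
Qed.

Lemma scomp_idr (V W : Type) (s : V -> term S W) : scomp s Var = s.
Proof. by apply/funext => v; exact: tsubst_id. Qed.

Lemma slift_comp (U V W : Type) (s : U -> term S V) (s' : V -> term S W) :
  scomp (slift s) (slift s') = slift (scomp s s').
Proof. by apply/funext => -[u|] //=; rewrite /scomp /= !tsubst_comp. Qed.

Lemma slift_id (V : Type) : slift Var = Var :> (option V -> term S (option V)).
Proof. by apply/funext => -[]. Qed.

Lemma slift_scons (U V W : Type) (s : U -> term S V) (s' : V -> term S W)
    (t : term S W) :
  scomp (slift s) (scons s' t) = scons (scomp s s') t.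
Proof. by apply/funext => -[u|] //=; rewrite /scomp /= tsubst_comp. Qed.

Lemma fsubst_comp (U : Type) (p : form S U) (V W : Type)
    (s : U -> term S V) (s' : V -> term S W) :
  fsubst (fsubst p s) s' = fsubst p (scomp s s').
Proof.
elim: p V W s s' => //=.
- by move=> {}U a V W s s'; rewrite asubst_comp.
- by move=> {}U I p IH V W s s'; congr fAnd; apply/funext => i; exact: IH.
- by move=> {}U I p IH V W s s'; congr fOr; apply/funext => i; exact: IH.
- by move=> {}U p IHp q IHq V W s s'; rewrite IHp IHq.
- by move=> {}U p IH V W s s'; rewrite IH slift_comp.
- by move=> {}U p IH V W s s'; rewrite IH slift_comp.
Qed.

Lemma fsubst_id (V : Type) (p : form S V) : fsubst p Var = p.
Proof.
elim: p => //=.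
- by move=> {}V a; rewrite asubst_id.
- by move=> {}V I p IH; congr fAnd; apply/funext.
- by move=> {}V I p IH; congr fOr; apply/funext.
- by move=> {}V p IHp q IHq; rewrite IHp IHq.
- by move=> {}V p IH; rewrite slift_id IH.
- by move=> {}V p IH; rewrite slift_id IH.
Qed.

Lemma fsubst_fweak (V W : Type) (p : form S V) (s : V -> term S W) :
  fsubst (fweak p) (slift s) = fweak (fsubst p s).
Proof. by rewrite /fweak !fsubst_comp; congr fsubst; apply/funext. Qed.

Lemma fsubst_finst (V W : Type) (p : form S (option V)) (t : term S V)
    (s : V -> term S W) :
  fsubst (finst p t) s = finst (fsubst p (slift s)) (tsubst s t).
Proof.
rewrite /finst !fsubst_comp slift_scons scomp_idr.
by congr fsubst; apply/funext => -[].
Qed.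

Definition block_subst (V W : Type) n (s : V -> term S W) (r : 'I_n -> term S W) :
    V + 'I_n -> term S W :=
  fun v => match v with inl u => s u | inr j => r j end.

(** The analogue of [slift] for passing under [n] binders at once. *)
Definition block_lift (V W : Type) n (s : V -> term S W) :
    V + 'I_n -> term S (W + 'I_n) :=
  block_subst (scomp s (Var \o inl)) (Var \o inr).

(** Abstracting over [Q] treats [fAll] and [fEx] together: a block commutes with substitution as
    soon as a single quantifier does. *)
Lemma fsubst_fQuants (Q : forall V : Type, form S (option V) -> form S V) :
  (forall (V W : Type) (p : form S (option V)) (s : V -> term S W),
     fsubst (Q V p) s = Q W (fsubst p (slift s))) ->
  forall (V W : Type) n (p : form S (V + 'I_n)) (s : V -> term S W),
  fsubst (fQuants Q p) s = fQuants Q (fsubst p (block_lift s)).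
Proof.
move=> QE V W; elim=> [|n IH] p s /=.
  rewrite !fsubst_comp; congr fsubst; apply/funext => -[u|[]//].
  by rewrite /= /scomp /= tsubst_comp [RHS]tsubst_id.
rewrite IH QE !fsubst_comp; congr (fQuants _ (Q _ _)).
congr fsubst; apply/funext => -[u|j]; rewrite /scomp /=.
  by rewrite /scomp /= !tsubst_comp.
by case: (unlift ord0 j).
Qed.

(** Axioms are sentences, so a substitution only changes the ambient variable type. This is why
    axioms survive every change of condition below. *)
Lemma fsubst_axiom_form (V W : Type) (a : coherent_axiom S) (s : V -> term S W) :
  fsubst (axiom_form V a) s = axiom_form W a.
Proof.
rewrite /axiom_form fsubst_fQuants //=; congr fQuants; congr fImp.
  by congr fAnd; apply/funext => i; rewrite !asubst_comp.
congr fOr; apply/funext => i; rewrite fsubst_fQuants //=; congr fQuants.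
congr fAnd; apply/funext => j; rewrite !asubst_comp; congr fAtom.
by congr asubst; apply/funext => -[].
Qed.

End Substitution.

(** * Natural deduction: substitution, cut and quantifier blocks *)

Section Deduction.
Variable S : signature.

(** Letting [G'] be any context that contains the image of [G] carries the induction through
    [ctx_cons] and [ctx_weak], and gives weakening for [s = Var]. *)
Lemma nd_subst (V : Type) (G : ctx S V) p :
  nd G p -> forall (W : Type) (s : V -> term S W) (G' : ctx S W),
  (forall q, G q -> G' (fsubst q s)) -> nd G' (fsubst p s).
Proof.
have cons_sub (U W : Type) (s : U -> term S W) (H : ctx S U) (H' : ctx S W) q :
    (forall r, H r -> H' (fsubst r s)) ->
    forall r, ctx_cons q H r -> ctx_cons (fsubst q s) H' (fsubst r s).
  by move=> HH' r [->|/HH']; [left|right].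
have weak_sub (U W : Type) (s : U -> term S W) (H : ctx S U) (H' : ctx S W) :
    (forall r, H r -> H' (fsubst r s)) ->
    forall r, ctx_weak H r -> ctx_weak H' (fsubst r (slift s)).
  move=> HH' _ [r Hr ->]; exists (fsubst r s); first exact: HH'.
  exact: fsubst_fweak.
elim=> {V G p} /=.
- by move=> V G p Gp W s G' GG'; apply/nd_hyp/GG'.
- by move=> *; exact: nd_topI.
- by move=> V G p _ IH W s G' GG'; apply/nd_botE/(IH _ s).
- by move=> V G I p _ IH W s G' GG'; apply: nd_andI => i; exact: IH.
- move=> V G I p i _ IH W s G' GG'.
  exact: (nd_andE (p := fun i => fsubst (p i) s) i (IH _ s _ GG')).
- by move=> V G I p i _ IH W s G' GG'; apply: (nd_orI (i := i)); exact: IH.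
- move=> V G I p q _ IHp _ IHq W s G' GG'.
  by apply: nd_orE (IHp _ s _ GG') _ => i; apply: IHq; exact: cons_sub.
- by move=> V G p q _ IH W s G' GG'; apply/nd_impI/IH/cons_sub.
- move=> V G p q _ IHpq _ IHp W s G' GG'.
  exact: nd_impE (IHpq _ s _ GG') (IHp _ s _ GG').
- by move=> V G p _ IH W s G' GG'; apply/nd_allI/IH/weak_sub.
- move=> V G p t _ IH W s G' GG'; rewrite fsubst_finst.
  exact: nd_allE (IH _ s _ GG').
- move=> V G p t _ IH W s G' GG'; apply: (nd_exI (t := tsubst s t)).
  by rewrite -fsubst_finst; exact: IH.
- move=> V G p q _ IHp _ IHq W s G' GG'.
  apply: nd_exE (IHp _ s _ GG') _; rewrite -fsubst_fweak.
  by apply/IHq/cons_sub/weak_sub.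
Qed.

Lemma nd_weaken (V : Type) (G G' : ctx S V) p :
  (forall q, G q -> G' q) -> nd G p -> nd G' p.
Proof.
move=> GG' Gp; rewrite -[p]fsubst_id; apply: nd_subst Gp _ _ _ _ => q /GG'.
by rewrite fsubst_id.
Qed.

(** Contexts may be infinite, so hypotheses are not discharged one at a time: induction on the
    derivation grafts the given derivations onto its leaves, renaming them by [nd_subst] under
    binders. *)
Lemma nd_cut (V : Type) (G : ctx S V) p :
  nd G p -> forall G' : ctx S V, (forall q, G q -> nd G' q) -> nd G' p.
Proof.
have cons_cut (U : Type) (H H' : ctx S U) q :
    (forall r, H r -> nd H' r) ->
    forall r, ctx_cons q H r -> nd (ctx_cons q H') r.
  move=> HH' r [->|/HH']; first by apply: nd_hyp; left.
  by apply: nd_weaken => r'; right.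
have weak_cut (U : Type) (H H' : ctx S U) :
    (forall r, H r -> nd H' r) ->
    forall r, ctx_weak H r -> nd (ctx_weak H') r.
  move=> HH' _ [r /HH' H'r ->]; apply: nd_subst H'r _ _ _ _ => r' H'r'.
  by exists r'.
elim=> {V G p}.
- by move=> V G p Gp G' GG'; exact: GG'.
- by move=> *; exact: nd_topI.
- by move=> V G p _ IH G' GG'; apply/nd_botE/IH.
- by move=> V G I p _ IH G' GG'; apply: nd_andI => i; exact: IH.
- by move=> V G I p i _ IH G' GG'; apply: nd_andE; exact: IH.
- by move=> V G I p i _ IH G' GG'; apply: (nd_orI (i := i)); exact: IH.
- move=> V G I p q _ IHp _ IHq G' GG'.
  by apply: nd_orE (IHp _ GG') _ => i; apply/IHq/cons_cut.
- by move=> V G p q _ IH G' GG'; apply/nd_impI/IH/cons_cut.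
- by move=> V G p q _ IHpq _ IHp G' GG'; apply: nd_impE (IHpq _ GG') (IHp _ GG').
- by move=> V G p _ IH G' GG'; apply/nd_allI/IH/weak_cut.
- by move=> V G p t _ IH G' GG'; apply/nd_allE/IH.
- by move=> V G p t _ IH G' GG'; apply: (nd_exI (t := t)); exact: IH.
- move=> V G p q _ IHp _ IHq G' GG'.
  by apply: nd_exE (IHp _ GG') _; apply/IHq/cons_cut/weak_cut.
Qed.

Lemma nd_subst_cut (V W : Type) (G : ctx S V) (G' : ctx S W)
    (s : V -> term S W) p :
  nd G p -> (forall q, G q -> nd G' (fsubst q s)) -> nd G' (fsubst p s).
Proof.
move=> Gp GG'; pose sG q := exists2 r, G r & q = fsubst r s.
apply: (nd_cut (G := sG)) => [|_ [r Gr ->]]; last exact: GG'.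
by apply: nd_subst Gp _ _ _ _ => q Gq; exists q.
Qed.

Lemma nd_fQuants_allE (V : Type) (G : ctx S V) n (p : form S (V + 'I_n))
    (r : 'I_n -> term S V) :
  nd G (fQuants (@fAll S) p) -> nd G (fsubst p (block_subst Var r)).
Proof.
elim: n p r => [|n IH] p r /=.
  by congr (nd G _); congr fsubst; apply/funext => -[u|[]].
(* [block_var] makes [ord0] the innermost bound variable, so the other variables are instantiated
   first and [r ord0] comes last. *)
move=> /(IH _ (r \o lift ord0)) /= /(nd_allE (r ord0)).
congr (nd G _); rewrite /finst !fsubst_comp; congr fsubst; apply/funext.
move=> -[u|j] //; rewrite /scomp /=.
by case: unliftP => [j' ->|->] //=; rewrite tsubst_comp [LHS]tsubst_id.
Qed.

(** Renaming both [G] and [q] along [inl] expresses the eigenvariable condition for the whole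
    block. *)
Lemma nd_fQuants_exE (V : Type) (G : ctx S V) n (p : form S (V + 'I_n))
    (q : form S V) :
  nd G (fQuants (@fEx S) p) ->
  nd (ctx_cons p (fun r => exists2 q, G q & r = fsubst q (Var \o inl)))
     (fsubst q (Var \o inl)) ->
  nd G q.
Proof.
elim: n p => [|n IH] p /= Gp pq.
  apply: (nd_cut (G := ctx_cons (fsubst p (Var \o @block_nil V)) G)); last first.
    by move=> r [->//|]; exact: nd_hyp.
  have -> : q = fsubst (fsubst q (Var \o inl)) (Var \o @block_nil V).
    by rewrite fsubst_comp [RHS]fsubst_id.
  apply: nd_subst pq _ _ _ _ => _ [->|[r Gr ->]]; first by left.
  by right; rewrite fsubst_comp (_ : scomp _ _ = Var) ?fsubst_id.
(* The outer [n] quantifiers are eliminated by induction; the innermost one is then a hypothesis,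
   opened by [nd_exE]. *)
apply: IH Gp _; apply: nd_exE; first by apply: nd_hyp; left.
have -> : fweak (fsubst q (Var \o inl)) =
    fsubst (fsubst q (Var \o inl)) (Var \o @block_var V n).
  by rewrite /fweak !fsubst_comp.
apply: nd_subst pq _ _ _ _ => _ [->|[r Gr ->]]; first by left.
right; exists (fsubst r (Var \o inl)); first by right; exists r.
by rewrite /fweak !fsubst_comp.
Qed.

End Deduction.

(** * Soundness of covers for derivability *)

Section Soundness.
Variables (S : signature) (K : category) (T : theory S).

Lemma derivable_subst (V W : Type) (A : set (atom S V)) (B : set (atom S W))
    (s : V -> term S W) p :
  asubst s @` A `<=` B -> derivable T A p -> derivable T B (fsubst p s).
Proof.
move=> AB Ap; apply: nd_subst Ap _ _ _ _ => _ [[a Ta ->]|[a Aa ->]].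
  by left; exists a => //; rewrite fsubst_axiom_form.
by right; exists (asubst s a) => //; apply: AB; exists a.
Qed.

(** Freshness makes [ext_vars X x] a disjoint union. The map [h] turns named variables back into the
    ones bound by a quantifier block. *)
Lemma ext_vars_split (X : {fset var}) k (x : 'I_k -> var) :
  fresh X x ->
  exists h : ext_vars X x -> X + 'I_k,
    (forall u, h (old_var x u) = inl u) /\ forall j, h (new_var X x j) = inr j.
Proof.
move=> [injx xX].
have hP (v : ext_vars X x) : exists w : X + 'I_k,
    val v = match w with inl u => val u | inr j => x j end.
  case: v => v /=; rewrite in_fsetU => /orP[vX|/imfsetP[/= j _ ->]].
    by exists (inl (FSetSub vX)).
  by exists (inr j).
have [h hE] := choice hP; exists h; split=> [u|j].
  have /= := hE (old_var x u); case: (h _) => [u' /val_inj -> //|j uE].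
  by have := xX j; rewrite -uE (valP u).
have /= := hE (new_var X x j); case: (h _) => [u jE|j' /injx -> //].
by have := xX j; rewrite jE (valP u).
Qed.

(** Induction on the cover. At an isomorphism, the derivation is transported back along the inverse.
    At an axiom, each branch derives [p] over an extension, and eliminating the disjunction and then
    the existential block of the axiom discharges what the extension added. *)
Lemma derivable_cover (C : cond S) (U : family K C) :
  cover T U -> forall p : form S (cvars C),
  (forall D (f : hom K D C), U (existT _ D f) ->
     derivable T (fact D) (fsubst p f)) ->
  derivable T (fact C) p.
Proof.
elim=> {C U} [C D f [g [fg _]] p Up|C a s x U Ta prem xfr _ IH p Up].
  have /(derivable_subst (hom_fact (h := g))) :
      derivable T (fact D) (fsubst p f).
    exact: Up.
  by rewrite fsubst_comp (funext fg) fsubst_id.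
have {}IH i : derivable T (fact (extend C (x i) s (ax_concl i)))
    (fsubst p (incl S (x i))).
  apply: IH => D g Ug; rewrite fsubst_comp.
  apply: (Up D (hcomp (ext_hom K C (x i) s (ax_concl i)) g)).
  by exists i => //; exists (existT _ D g).
rewrite /derivable; set G := (G in nd G _).
(* The axiom is instantiated at [s]; its premise then consists of facts of [C], by [prem]. *)
have /(nd_fQuants_allE s) /= axE : nd G (axiom_form _ a).
  by apply: nd_hyp; left; exists a.
have {axE} orE := nd_impE axE _.
apply: nd_orE (orE _) _ => [|i].
  apply: nd_andI => j; apply: nd_hyp; right; rewrite asubst_comp.
  by eexists; last reflexivity; apply: prem; eexists; first by exists j.
rewrite fsubst_fQuants //.
apply: nd_fQuants_exE; first by apply: nd_hyp; left.
have [h [h_old h_new]] := ext_vars_split (xfr i).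
have h_incl : scomp (incl S (x i)) (Var \o h) = Var \o inl :> (_ -> term S _).
  by apply/funext => u; rewrite /scomp /= h_old.
rewrite -h_incl -fsubst_comp /=.
(* The hypotheses of the branch are axioms, old facts of [C], and instantiated conjuncts of the
   [i]-th conclusion. *)
apply: nd_subst_cut (IH i) _ => _ [[b Tb ->]|[_ [[c Cc <-]|[_ [j _ <-] <-]] ->]].
- apply: nd_hyp; right; exists (axiom_form _ b); last by rewrite !fsubst_axiom_form.
  by right; left; exists b.
- apply: nd_hyp; right; exists (fAtom c); first by right; right; exists c.
  by rewrite /= asubst_comp h_incl.
(* The [l]-th conjunct in the shape it has in the opened existential hypothesis. *)
pose c l := asubst (block_lift (block_subst Var s)) (asubst
  (fun v => Var (match v with inl u => inl (inr u) | inr l => inr l end))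
  (tnth (in_tuple (ax_concl i)) l)).
rewrite /= asubst_comp (_ : asubst _ _ = c j); last first.
  rewrite /c asubst_comp; congr asubst; apply/funext => -[u|l].
    by rewrite /scomp /= tsubst_comp h_incl.
  by rewrite /scomp /= h_new.
by apply: (nd_andE (p := fun l => fAtom (c l)) j); apply: nd_hyp; left.
Qed.

(** * From forcing to derivability *)

Lemma id_admissible (V : Type) : admissible K (Var : V -> term S V).
Proof.
have vs (v : V) : exists w : V, Var v = Var w :> term S V by exists v.
by case: K => //=; split=> // u v [].
Qed.

(** The identity alone is a cover, and morphisms preserve facts. *)
Lemma forces_fact (C : cond S) (V : Type) (r : V -> term S (cvars C)) a :
  fact C (asubst r a) -> forces K T (fAtom a) r.
Proof.
move=> Ca.
have id_fact : asubst Var @` fact C `<=` fact C.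
  by move=> _ [b Cb <-]; rewrite asubst_id.
pose i := Hom id_fact (@id_admissible (cvars C)).
have i_iso : is_iso i by exists i; split=> v.
apply: (ex_intro2 _ _ _ (cover_iso T i_iso)) => D f _.
by rewrite -asubst_comp; apply: (hom_fact (h := f)); exists (asubst r a).
Qed.

(** [C] and [r] stay general because disjunctions, quantifiers and implications apply the induction
    hypothesis at another condition. *)
Lemma forces_derivable (V : Type) (p : form S V) :
  gen_geom_impl p -> forall (C : cond S) (r : V -> term S (cvars C)),
  forces K T p r -> derivable T (fact C) (fsubst p r).
Proof.
elim=> {V p}.
- move=> V _ [||a] C r /=.
  + by move=> _; exact: nd_topI.
  (* The cover is empty, so nothing remains to be derived on it. *)
  + by move=> U; apply: derivable_cover U _ _ => D f.
  + move=> [U covU Ua]; apply: derivable_cover covU _ _ => D f Uf.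
    apply: nd_hyp; right; exists (asubst (scomp r f) a); first exact: Ua.
    by rewrite /= asubst_comp.
- move=> V p q _ IHp _ IHq C r /= pq; apply: nd_andI => -[].
  + by apply: IHp; exact: (pq true).
  + by apply: IHq; exact: (pq false).
- move=> V I p _ IH C r [U covU Up]; apply: derivable_cover covU _ _ => D f Uf.
  have [i Dpi] := Up D f Uf; rewrite fsubst_comp /=.
  by apply: (nd_orI (i := i)); exact: IH.
- move=> V p _ IH C r [U covU Up]; apply: derivable_cover covU _ _ => D f Uf.
  have [t pt] := Up D f Uf; rewrite fsubst_comp /=.
  apply: (nd_exI (t := t)); rewrite /finst fsubst_comp slift_scons scomp_idr.
  exact: IH.
- move=> V p _ IH C r /= Cp; apply: nd_allI.
  have /infinite_setN0[v0 [_ v0X]] : infinite_set ([set: var] `\` [set` cvars C]).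
    by apply: infinite_setD infinite_nat _.
  pose x (_ : 'I_1) := v0.
  have xfr : fresh (cvars C) x.
    by split=> [i j|j]; [rewrite !ord1|exact/negP].
  (* [D] adds the single variable [v0] and no new facts; [v0] serves as the generic element. *)
  pose D := Cond (finite_image (asubst (@incl S (cvars C) 1 x)) (@fact_finite S C)).
  pose f := @Hom S K D C (incl S x) (fun _ => id) (incl_admissible K C x).
  have := IH D _ (Cp D f (Var (new_var (cvars C) x ord0))).
  have [h [h_old h_new]] := ext_vars_split xfr.
  (* Together, [h] and [b] rename [v0] to the bound variable [None]. *)
  pose b (w : cvars C + 'I_1) := if w is inl u then Some u else None.
  have h_incl : scomp (incl S x) (Var \o b \o h) = Var \o Some :> (_ -> term S _).
    by apply/funext => u; rewrite /scomp /= h_old.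
  move=> /nd_subst /(_ _ (Var \o b \o h)).
  rewrite fsubst_comp (_ : scomp _ _ = slift r); last first.
    apply/funext => -[u|]; rewrite /scomp /= ?h_new //.
    by rewrite tsubst_comp h_incl.
  apply=> _ [[a Ta ->]|[_ [a Ca <-] ->]].
    exists (axiom_form _ a); last by rewrite /fweak !fsubst_axiom_form.
    by left; exists a.
  exists (fAtom a); first by right; exists a.
  by rewrite /fweak /= asubst_comp h_incl.
- move=> V a p /= base _ IH C r Cp.
  (* A singleton if [a] is an atom and empty if it is [fTop] or [fBot], so one extension [D] serves
     all basic premises. *)
  pose B := [set b | fsubst a r = fAtom b].
  have finB : finite_set B.
    rewrite /B; case: base => [||b]; first 2 last.
    + by apply: sub_finite_set (finite_set1 (asubst r b)) => c /= [->].
    + by apply: sub_finite_set (finite_set0 _) => c.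
    + by apply: sub_finite_set (finite_set0 _) => c.
  (* A premise [fBot] is set apart: there the implication holds by ex falso, while the other basic
     premises are forced as soon as their atoms are facts. *)
  have base_forces (D : cond S) (s : V -> term S (cvars D)) :
      a = fBot \/ ((forall b, fsubst a s = fAtom b -> fact D b) -> forces K T a s).
    case: base => [||b]; [by right|by left|right=> Db].
    by apply: forces_fact; exact: Db.
  have finCB : finite_set (fact C `|` B).
    by rewrite finite_setU; split=> //; exact: fact_finite.
  pose D := Cond finCB.
  have D_fact : asubst Var @` fact C `<=` fact D.
    by move=> _ [b Cb <-]; rewrite asubst_id; left.
  pose f := @Hom S K D C Var D_fact (@id_admissible (cvars C)).
  apply: nd_impI.
  have [->|Da] := base_forces D (scomp r f).
    exact/nd_botE/nd_hyp/or_introl.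
  have {}Da : forces K T a (scomp r f : V -> term S (cvars D)).
    by apply: Da => b; rewrite scomp_idr; right.
  have := IH D _ (Cp D f Da).
  rewrite scomp_idr; apply: nd_weaken => q [Tq|[b [Cb|Bb] ->]].
  + by right; left.
  + by right; right; exists b.
  + by left.
Qed.

End Soundness.

Theorem theorem5p8 (S : signature) (K : category) (T : theory S)
  (Y : set var) (phi : form S Y) (C : cond S) (rho : Y -> term S (cvars C)) :
  gen_geom_impl phi ->
  forces K T phi rho ->
  derivable T (fact C) (fsubst phi rho).
Proof. by move=> /forces_derivable; apply. Qed.
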